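(* Let $1\le p<\infty$ with conjugate exponent $q$. Let $f\in L'^{\,p}$ with primitive $F\in L^p$ and let $G\in I^q$ with $G(x)=\int_0^x g(t)\,dt$, $g\in L^q$. For $x\in\mathbb R$ define $f\ast G(x)=\int_{-\infty}^\infty f_x G$, where $f_x\in L'^{\,p}$ is the distribution $y\mapsto f(x-y)$, i.e. the distributional derivative of $y\mapsto -F(x-y)$. Then: (a) $f\ast G=F\ast g=g\ast F$ (Lebesgue convolutions), $f\ast G\in L^\infty$, $\|f\ast G\|_\infty\le\|f\|'_p\|G\|_{I,q}$, and $f\ast G$ is uniformly continuous on $\mathbb R$. (b) $f\ast k=0$ for each constant $k\in\mathbb R$. (c) If $p=1$ (so $g\in L^\infty$) and $h\in L^1$ with $\int_{-\infty}^\infty|y\,h(y)|\,dy<\infty$, then $G\ast h$ exists on $\mathbb R$, $G\ast h-(G\ast h)(0)\in I^\infty$, and $f\ast(G\ast h)=(f\ast G)\ast h$, where $f\ast(G\ast h)$ means $f\ast(G\ast h-(G\ast h)(0))$. (d) For each $z\in\mathbb R$, $\tau_z(f\ast G)=(\tau_zf)\ast G=f\ast(\tau_zG)$. (e) For fixed $f$, $\Phi_f:I^q\to L^\infty$, $\Phi_f[G]=f\ast G$, is a bounded linear operator with $\|\Phi_f\|=\|f\|'_p$. For fixed $G$, $\Psi_G:L'^{\,p}\to L^\infty$, $\Psi_G[f]=f\ast G$, is a bounded linear operator; if $1<p<\infty$ then $\|\Psi_G\|=\|G\|_{I,q}$, and if $p=1$ then $\|\Psi_G\|\le\|G\|_{I,\infty}$.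 (f) $\mathrm{supp}(f\ast G)\subseteq\overline{\mathrm{supp}(F)+\mathrm{supp}(g)}$.
   Context: All function spaces are over $\mathbb R$ with Lebesgue measure. Conjugate exponent: $1/p+1/q=1$, $q=\infty$ if $p=1$. $L'^{\,p}=\{f\in\mathcal S' : f=F' \text{ (distributional derivative) for some } F\in L^p\}$; the $F\in L^p$ is unique and called the primitive of $f$; $\|f\|'_p:=\|F\|_p$. $I^q=\{G : G(x)=\int_0^x g(t)\,dt,\ g\in L^q\}$, $G':=g$, $\|G\|_{I,q}:=\|G'\|_q$. The integral is $\int_{-\infty}^\infty fG:=-\int_{-\infty}^\infty F(x)G'(x)\,dx$, and $\int f\,a:=0$ for constants $a$. Translation: $\tau_z\psi(x)=\psi(x-z)$ for functions; for distributions $\langle\tau_zT,\phi\rangle=\langle T,\tau_{-z}\phi\rangle$. Supports of $L^p$ functions are essential supports. *)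

(* Defs.v *)
From HB Require Import structures.
From mathcomp Require Import all_boot all_order all_algebra.
From mathcomp Require Import all_classical all_reals all_analysis.
Set Implicit Arguments. Unset Strict Implicit. Unset Printing Implicit Defensive.
Import Order.TTheory GRing.Theory Num.Theory.
Import numFieldNormedType.Exports.
Local Open Scope classical_set_scope.
Local Open Scope ring_scope.

Section Defs.
Context {R : realType}.
Local Notation mu := (@lebesgue_measure R).

Definition Lp (p : \bar R) (f : R -> R) : Prop :=
  measurable_fun [set: R] f /\ finite_norm mu p f.

Definition normp (p : \bar R) (f : R -> R) : \bar R := 'N[mu]_p[EFin \o f].

Definition conj_exp (p : R) : \bar R :=
  if p == 1 then +oo%E else (p / (p - 1))%:E.

Definition oint (g : R -> R) (x : R) : R :=
  if 0 <= x then Rintegral mu `[0, x] g else - Rintegral mu `[x, 0] g.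

Definition Iq_with (q : \bar R) (G g : R -> R) : Prop :=
  Lp q g /\ forall x, G x = oint g x.
Definition inIq (q : \bar R) (G : R -> R) : Prop := exists g, Iq_with q G g.

(* A derivative in L^q of H - H(0) (when H - H(0) \in I^q; unique a.e.),
   chosen classically; 0 otherwise. *)
Definition Ider (q : \bar R) (H : R -> R) : R -> R :=
  match pselect
          (exists g, Iq_with q (fun x => H x - H 0) g) with
  | left P => proj1_sig (cid P)
  | right _ => fun _ => 0
  end.

(* Elements f of L'^p are represented by their (unique) primitive F \in L^p.
   The integral  int f G := - int F G'  (and int f a := 0 for constants a,
   so that in general int f H := - int F (H - H(0))'). *)
Definition dint (q : \bar R) (F H : R -> R) : R :=
  - Rintegral mu [set: R] (fun y => F y * Ider q H y).

(* primitive of the distribution f_x : y |-> f(x - y) *)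
Definition refl_prim (F : R -> R) (x : R) : R -> R := fun y => - F (x - y).

Definition dconv (p : R) (F H : R -> R) : R -> R :=
  fun x => dint (conj_exp p) (refl_prim F x) H.

Definition lconv (u v : R -> R) : R -> R :=
  fun x => Rintegral mu [set: R] (fun y => u (x - y) * v y).
Definition conv_exists (u v : R -> R) (x : R) : Prop :=
  mu.-integrable [set: R] (fun y => (u (x - y) * v y)%:E).

Definition transl (z : R) (psi : R -> R) : R -> R := fun x => psi (x - z).

Definition esupp (f : R -> R) : set R :=
  ~` \bigcup_(U in [set U : set R | open U /\ {ae mu, forall x, U x -> f x = 0}]) U.

Definition minksum (A B : set R) : set R := [set a + b | a in A & b in B].

Definition opnorm_Phi (p : R) (F : R -> R) : \bar R :=
  ereal_sup [set normp +oo%E (dconv p F (oint g)) | g in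
              [set g | Lp (conj_exp p) g /\ (normp (conj_exp p) g <= 1)%E]].
Definition opnorm_Psi (p : R) (G : R -> R) : \bar R :=
  ereal_sup [set normp +oo%E (dconv p F G) | F in
              [set F | Lp p%:E F /\ (normp p%:E F <= 1)%E]].
End Defs.

(* Main.v *)
(** Each [G] in [I^q] is an integral [oint g], and by Lebesgue differentiation
[g] is determined almost everywhere by [G]; hence [f * G] is the Lebesgue
convolution [F * g], and everything is read off that convolution. Boundedness
is Hoelder's inequality. Uniform continuity is continuity of translations in
[L^p]: truncate [F] to a bounded function of bounded support, for which the
[L^p] modulus is controlled by the [L^1] modulus, and approximate in [L^1] by
continuous functions. The operator norms are attained at the
extremizers [sgn u |u|^(p-1)] of Hoelder's inequality, evaluated at the origin:
the sup norm of a continuous function dominates its value there. Part (c) is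
one application of Fubini's theorem, used twice, after replacing [g] by a
representative that is bounded everywhere. *)

Require Import Defs.
From HB Require Import structures.
From mathcomp Require Import all_boot all_order all_algebra.
From mathcomp Require Import all_classical all_reals all_analysis.
From mathcomp Require Import measurable_realfun ess_sup_inf lra.
Set Implicit Arguments.
Unset Strict Implicit.
Unset Printing Implicit Defensive.
Import Order.TTheory GRing.Theory Num.Theory.
Import numFieldNormedType.Exports.
Local Open Scope classical_set_scope.
Local Open Scope ring_scope.

(** * Invariance of Lebesgue measure under translations and reflections *)

Section measure_preserving.
Context {R : realType}.
Local Notation mu := (@lebesgue_measure R).
Implicit Types (phi f : R -> R) (x z : R).

(** A single notion covers translations and the reflections $y\mapsto x-y$, so integrals, norms and
    null sets are transported along both by the same lemmas. *)
Definition mu_preserving phi := measurable_fun [set: R] phi /\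
  forall A : set R, measurable A -> mu (phi @^-1` A) = mu A.

(** The pushforward under a translation agrees with Lebesgue measure on half-open intervals, and
    such a measure is unique. *)
Lemma mu_preserving_shift z : mu_preserving (fun y => y + z).
Proof.
have mz : measurable_fun [set: R] (fun y : R => y + z) by exact: measurable_funD.
split=> // A mA.
rewrite -[LHS]/(pushforward mu (fun y : R => (y + z : measurableTypeR R)) A).
apply/esym/lebesgue_measure_unique => //= _ [[a b]] _ <-; rewrite /pushforward.
rewrite (_ : _ @^-1` _ = `]a - z, b - z]%classic); last first.
  by apply/seteqP; split => y /=; rewrite !in_itv/= ltrBlDr lerBrDr.
rewrite !lebesgue_measure_itv/= !lte_fin ltrD2r.
by case: ifP => // _; congr (_%:E); lra.
Qed.

Lemma mu_preserving_refl x : mu_preserving (fun y => x - y).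
Proof.
have [ms sE] := mu_preserving_shift x.
have mx : measurable_fun [set: R] (fun y : R => x - y) by exact: measurable_funB.
split=> // A mA.
rewrite (_ : _ @^-1` _ = -%R @^-1` ((fun y => y + x) @^-1` A)); last first.
  by apply/seteqP; split => y /=; rewrite addrC.
rewrite -[X in _ = X](sE _ mA) -[RHS]lebesgue_measureN//.
by rewrite -[X in measurable X]setTI; exact: ms.
Qed.

Lemma mu_preserving_shiftN z : mu_preserving (fun y => y - z).
Proof. exact: mu_preserving_shift. Qed.

Lemma measurable_preserving phi f : mu_preserving phi ->
  measurable_fun setT f -> measurable_fun setT (fun y => f (phi y)).
Proof. by move=> [mphi _] mf; exact: measurableT_comp. Qed.

Lemma ge0_integral_preserving phi (f : R -> \bar R) : mu_preserving phi ->
  measurable_fun setT f -> (forall y, 0 <= f y)%E ->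
  (\int[mu]_y f (phi y) = \int[mu]_y f y)%E.
Proof.
move=> [mphi phiE] mf f0.
pose phi' : measurableTypeR R -> measurableTypeR R := phi.
rewrite -[X in integral _ X _](@preimage_setT _ _ phi').
rewrite -(@ge0_integral_pushforward _ _ _ _ _ phi' _ _ setT f)//.
by apply: eq_measure_integral => A mA _; rewrite /= /pushforward phiE.
Qed.

Lemma integral_preserving phi (f : R -> \bar R) : mu_preserving phi ->
  measurable_fun setT f -> (\int[mu]_y f (phi y) = \int[mu]_y f y)%E.
Proof.
move=> pphi mf; rewrite integralE [RHS]integralE.
rewrite -(@ge0_integral_preserving phi f^\+%E)//; last exact: measurable_funepos.
rewrite -(@ge0_integral_preserving phi f^\-%E)//; last exact: measurable_funeneg.
by congr (_ - _)%E; apply: eq_integral => y _; rewrite (funepos_comp, funeneg_comp).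
Qed.

Lemma Rintegral_preserving phi f : mu_preserving phi ->
  measurable_fun setT f ->
  Rintegral mu setT (fun y => f (phi y)) = Rintegral mu setT f.
Proof.
move=> pphi mf; rewrite /Rintegral; congr fine.
by rewrite (@integral_preserving phi (EFin \o f))//; exact/measurable_EFinP.
Qed.

Lemma integrable_preserving phi (f : R -> \bar R) : mu_preserving phi ->
  mu.-integrable setT f -> mu.-integrable setT (fun y => f (phi y)).
Proof.
move=> pphi /integrableP[mf foo]; apply/integrableP; split.
  by case: pphi => mphi _; exact: (measurableT_comp mf mphi).
rewrite (@ge0_integral_preserving phi (fun y => `|f y|%E))//.
exact: measurableT_comp.
Qed.

Lemma ae_preserving phi (P : set R) : mu_preserving phi ->
  {ae mu, forall y, P y} -> {ae mu, forall y, P (phi y)}.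
Proof.
move=> [mphi phiE] [N [mN N0 PN]].
exists (phi @^-1` N); split.
- by rewrite -[X in measurable X]setTI; exact: mphi.
- by rewrite phiE.
- by move=> y /= Py; exact: PN.
Qed.

Lemma ae_imp (P Q : set R) : (forall y, P y -> Q y) ->
  {ae mu, forall y, P y} -> {ae mu, forall y, Q y}.
Proof.
move=> PQ [N [mN N0 PN]]; exists N; split=> // y /= nQ.
by apply: PN => /= /PQ.
Qed.

Lemma ae_and (P Q : set R) : {ae mu, forall y, P y} ->
  {ae mu, forall y, Q y} -> {ae mu, forall y, P y /\ Q y}.
Proof. exact: (@filterI _ _ (ae_filter_ringOfSetsType mu)). Qed.

(** * $L^p$ norms and $L^p$ spaces: invariance and linear structure *)

Lemma normp_preserving phi (r : R) f : mu_preserving phi ->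
  measurable_fun setT f ->
  normp r%:E (fun y => f (phi y)) = normp r%:E f.
Proof.
move=> pphi mf; rewrite /normp unlock; congr (_ `^ _)%E.
rewrite -(@ge0_integral_preserving phi (fun y => (`|(f y)%:E| `^ r)%E))//; last first.
  by move=> y; exact: poweR_ge0.
have mE : measurable_fun [set: R] (EFin \o f) by exact/measurable_EFinP.
exact: (measurableT_comp (measurable_poweR r)
  (measurableT_comp (@abse_measurable R setT) mE)).
Qed.

(** The norm with exponent $\infty$ unfolds to an essential supremum only on a space of positive
    measure; this settles that side condition for [normpyE]. *)
Lemma mu_setT_gt0 : (0 < mu [set: R])%E.
Proof.
rewrite (@lt_le_trans _ _ (mu `[0%R, 1%R]%classic))//; last first.
  by rewrite le_measure ?inE.
by rewrite lebesgue_measure_itv/= lte_fin ltr01 oppr0 adde0.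
Qed.

Lemma normpyE f : normp +oo%E f = ess_sup mu (fun y => `|f y|%:E).
Proof. by rewrite /normp unlock /= mu_setT_gt0. Qed.

Lemma normpy_le f (M : R) : {ae mu, forall y, `|f y| <= M} ->
  (normp +oo%E f <= M%:E)%E.
Proof. by move=> fM; rewrite normpyE; apply/ess_supP. Qed.

Lemma normpy_ae f : Lp +oo%E f ->
  {ae mu, forall y, `|f y| <= fine (normp +oo%E f)}.
Proof.
move=> [_ foo]; have := ess_sup_ge mu (fun y => `|f y|%:E).
apply: filterS => y; rewrite -normpyE -lee_fin fineK//.
by rewrite ge0_fin_numE//; exact: Lnorm_ge0.
Qed.

Lemma Lp_preserving phi (q : \bar R) f : (1 <= q)%E -> mu_preserving phi ->
  Lp q f -> Lp q (fun y => f (phi y)).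
Proof.
move=> q1 pphi lf; have [mf foo] := lf; split; first exact: measurable_preserving.
case: q q1 lf foo => // [r|] _ lf foo.
  by rewrite /finite_norm -/(normp r%:E _) normp_preserving.
rewrite /finite_norm -/(normp _ _).
apply: le_lt_trans (normpy_le (ae_preserving pphi (normpy_ae lf))) _.
exact: ltry.
Qed.

Lemma LpP (q : \bar R) f : Lp q f <-> f \in Lfun mu q.
Proof.
split=> [[mf foo]|].
  by rewrite inE; apply/andP; rewrite !inE.
by rewrite inE => /andP[]; rewrite !inE.
Qed.

Lemma LpD (q : \bar R) f g : (1 <= q)%E -> Lp q f -> Lp q g -> Lp q (f \+ g).
Proof.
move=> q1 /LpP lf /LpP lg; apply/LpP.
exact: (proj2 (@Lfun_addr_closed _ _ _ mu q q1) f g lf lg).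
Qed.

Lemma LpZ (q : \bar R) a f : (1 <= q)%E -> Lp q f -> Lp q (fun x => a * f x).
Proof.
move=> q1 /LpP lf; apply/LpP.
have [h0 /(_ a f 0 lf h0)] := @Lfun_submod_closed _ _ _ mu q q1.
by rewrite addr0.
Qed.

Lemma Lp0 (q : \bar R) : (1 <= q)%E -> Lp q (fun=> 0 : R).
Proof.
move=> q1; apply/LpP; exact: (proj1 (@Lfun_submod_closed _ _ _ mu q q1)).
Qed.

Lemma LpB (q : \bar R) f g : (1 <= q)%E -> Lp q f -> Lp q g -> Lp q (f \- g).
Proof.
move=> q1 lf lg; rewrite (_ : f \- g = f \+ (fun x => -1 * g x)); last first.
  by apply/funext => x /=; rewrite mulN1r.
by apply: LpD => //; exact: LpZ.
Qed.

Local Notation Int := (Rintegral mu [set: R]).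

Lemma eq_IntR f g : f =1 g -> Int f = Int g.
Proof. by move=> fg; apply: eq_Rintegral => y _; exact: fg. Qed.

Lemma IntRZ k f : mu.-integrable setT (EFin \o f) ->
  Int (fun y => k * f y) = k * Int f.
Proof. by move=> fi; exact: RintegralZl. Qed.

Lemma IntRD f g : mu.-integrable setT (EFin \o f) ->
  mu.-integrable setT (EFin \o g) -> Int (fun y => f y + g y) = Int f + Int g.
Proof. by move=> fi gi; exact: RintegralD. Qed.

Lemma IntRB f g : mu.-integrable setT (EFin \o f) ->
  mu.-integrable setT (EFin \o g) -> Int (fun y => f y - g y) = Int f - Int g.
Proof. by move=> fi gi; exact: RintegralB. Qed.

Lemma IntR0 : Int (fun=> 0) = 0.
Proof. by rewrite Rintegral_cst// mul0r. Qed.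

Lemma ae_eq_IntR f g : measurable_fun setT f -> measurable_fun setT g ->
  {ae mu, forall y, f y = g y} -> Int f = Int g.
Proof.
move=> mf mg fg; congr fine; apply: ae_eq_integral => //.
- exact/measurable_EFinP.
- exact/measurable_EFinP.
- by apply: ae_imp fg => y -> _.
Qed.

End measure_preserving.

(** * The pairing of conjugate exponents and the reduction to Lebesgue convolutions *)

Section hoelder_pairing.
Context {R : realType}.
Local Notation mu := (@lebesgue_measure R).
Implicit Types (p x a b : R) (f g F G H : R -> R).

Lemma conj_exp1 : conj_exp (1 : R) = +oo%E.
Proof. by rewrite /conj_exp eqxx. Qed.

Lemma conj_expE p : 1 < p -> conj_exp p = (p / (p - 1))%:E.
Proof. by move=> p1; rewrite /conj_exp gt_eqF. Qed.

Lemma conj_exp_gt1 p : 1 < p -> 1 < p / (p - 1).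
Proof. by move=> p1; rewrite ltr_pdivlMr ?subr_gt0//; lra. Qed.

Lemma conj_exp_ge1 p : 1 <= p -> (1 <= conj_exp p)%E.
Proof.
rewrite le_eqVlt => /predU1P[<-|p1]; first by rewrite conj_exp1 leey.
by rewrite conj_expE// lee_fin ltW// conj_exp_gt1.
Qed.

Lemma conj_expV p : 1 < p -> p^-1 + (p / (p - 1))^-1 = 1.
Proof.
move=> p1; rewrite invf_div -{1}[p^-1]mul1r -mulrDl addrC subrK divff//.
by rewrite gt_eqF// (lt_trans ltr01).
Qed.

Lemma conj_expK p : 1 < p -> conj_exp (p / (p - 1)) = p%:E.
Proof.
move=> p1; have p0 : p - 1 != 0 by rewrite subr_eq0 gt_eqF.
rewrite conj_expE ?conj_exp_gt1//; congr (_%:E).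
by rewrite -[X in _ / (_ - X)](divff p0) -mulrBl subKr div1r invrK divfK.
Qed.

Lemma Lp_fine (q : \bar R) f : Lp q f -> normp q f = (fine (normp q f))%:E.
Proof.
by move=> [_ foo]; rewrite fineK// ge0_fin_numE//; exact: Lnorm_ge0.
Qed.

Lemma normp_ge0 (q : \bar R) f : (0 <= normp q f)%E.
Proof. exact: Lnorm_ge0. Qed.

(** For $p=1$ the factor $g$ is bounded almost everywhere by its sup norm, which is pulled out of
    the integral; for $p>1$ this is Hoelder with $1/p+1/q=1$. *)
Lemma hoelder_conj p f g : 1 <= p -> Lp p%:E f -> Lp (conj_exp p) g ->
  (\int[mu]_y `|f y * g y|%:E <= normp p%:E f * normp (conj_exp p) g)%E.
Proof.
rewrite le_eqVlt => /predU1P[<-|p1] lf lg; have [mf _] := lf; have [mg _] := lg.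
  rewrite conj_exp1 in lg *.
  rewrite (Lp_fine lg) /normp Lnorm1 -ge0_integralZr//; last 2 first.
  - by apply/measurable_EFinP; exact: measurableT_comp.
  - by rewrite lee_fin fine_ge0// normp_ge0.
  apply: ae_ge0_le_integral => //.
  - by apply/measurable_EFinP; apply: measurableT_comp => //; exact: measurable_funM.
  - by move=> y _; rewrite mule_ge0// lee_fin fine_ge0// normp_ge0.
  - by apply: emeasurable_funM => //; apply/measurable_EFinP; exact: measurableT_comp.
  - apply: ae_imp (normpy_ae lg) => y gy _.
    by rewrite normrM EFinM lee_pmul// lee_fin.
rewrite conj_expE// in lg *.
have := @hoelder _ _ R mu f g p (p / (p - 1)) mf mg _ _ (conj_expV p1).
rewrite Lnorm1; apply; first by rewrite (lt_trans ltr01).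
by rewrite (lt_trans ltr01)// conj_exp_gt1.
Qed.

Lemma integrable_conj p f g : 1 <= p -> Lp p%:E f -> Lp (conj_exp p) g ->
  mu.-integrable setT (fun y => (f y * g y)%:E).
Proof.
move=> p1 lf lg; have [mf _] := lf; have [mg _] := lg; apply/integrableP; split.
  by apply/measurable_EFinP; exact: measurable_funM.
apply: le_lt_trans (hoelder_conj p1 lf lg) _.
by rewrite (Lp_fine lf) (Lp_fine lg) ltry.
Qed.

Lemma Rintegral_conj_le p f g : 1 <= p -> Lp p%:E f -> Lp (conj_exp p) g ->
  (`|Rintegral mu setT (fun y => f y * g y)|%:E
     <= normp p%:E f * normp (conj_exp p) g)%E.
Proof.
move=> p1 lf lg; apply: le_trans (hoelder_conj p1 lf lg).
rewrite EFin_normr_Rintegral//; last exact: (integrable_conj p1 lf lg).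
apply: le_abse_integral => //.
exact: measurable_int (integrable_conj p1 lf lg).
Qed.

Lemma Lp_indic p (A : set R) : 1 <= p -> measurable A -> (mu A < +oo)%E ->
  Lp p%:E (\1_A : R -> R).
Proof.
move=> p1 mA Aoo; split; first exact: measurable_indic.
rewrite /finite_norm unlock poweR_lty//.
rewrite [X in (X < _)%E](_ : _ = mu A)// -[in RHS](setIT A) -integral_indic//.
apply: eq_integral => y _; rewrite /= indicE; case: (_ \in _) => /=.
  by rewrite normr1 powR1.
by rewrite normr0 powR0// gt_eqF// (lt_le_trans ltr01).
Qed.

(** Hoelder's inequality is applied against the indicator of $A$, which lies in $L^p$ because $A$
    has finite measure. *)
Lemma Lp_conj_integrable p g (A : set R) : 1 <= p -> Lp (conj_exp p) g ->
  measurable A -> (mu A < +oo)%E -> mu.-integrable A (EFin \o g).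
Proof.
move=> p1 lg mA Aoo; apply/(@integrable_mkcond _ _ R mu A (EFin \o g) mA).
apply: eq_integrable (integrable_conj p1 (Lp_indic p1 mA Aoo) lg) => //.
by move=> y _; rewrite patchE indicE; case: (y \in A); rewrite /= ?mul1r ?mul0r.
Qed.

Lemma Lp_conj_locally_integrable p g : 1 <= p -> Lp (conj_exp p) g ->
  locally_integrable setT g.
Proof.
move=> p1 lg; have [mg _] := lg; split => //; first exact: openT.
move=> K _ cK.
by have /integrableP[] := Lp_conj_integrable p1 lg (compact_measurable cK)
  (compact_finite_measure cK).
Qed.

(* [oint g x] is the integral of [g] against [oint_kernel x]; this form makes
   the translation behaviour of [oint] an exact identity between kernels. *)
Definition oint_kernel x (t : R) : R := (t <= x)%R%:R - (t <= 0)%R%:R.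

Lemma oint_kernel_ge0 x : 0 <= x -> oint_kernel x = \1_(`]0, x]%classic).
Proof.
move=> x0; apply/funext => t; rewrite /oint_kernel indicE mem_setE in_itv/=.
case: (leP t 0) => t0 /=; last by rewrite subr0.
by rewrite (le_trans t0 x0) subrr.
Qed.

Lemma oint_kernel_le0 x : x <= 0 ->
  oint_kernel x = (fun t => - 1 * \1_(`]x, 0]%classic) t).
Proof.
move=> x0; apply/funext => t; rewrite /oint_kernel indicE mem_setE in_itv/=.
case: (leP t x) => tx /=; first by rewrite (le_trans tx x0) subrr mulr0.
by case: (t <= 0); rewrite ?mulr1 ?mulr0 ?subrr// sub0r.
Qed.

Lemma mu_itv_oc_lty a b : (mu `]a, b]%classic < +oo)%E.
Proof. by rewrite lebesgue_measure_itv/=; case: ifP => _ //; rewrite ltry. Qed.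

Lemma Lp_oint_kernel p x : 1 <= p -> Lp p%:E (oint_kernel x).
Proof.
move=> p1; case: (leP 0 x) => x0.
  rewrite oint_kernel_ge0//; apply: Lp_indic => //; exact: mu_itv_oc_lty.
rewrite (oint_kernel_le0 (ltW x0)); apply: LpZ; first by rewrite lee_fin.
by apply: Lp_indic => //; exact: mu_itv_oc_lty.
Qed.

Lemma Rintegral_indicM (A : set R) g :
  Rintegral mu A g = Rintegral mu setT (fun t => \1_A t * g t).
Proof.
rewrite Rintegral_mkcond; apply: eq_IntR => t; rewrite patchE indicE.
by case: (_ \in _); rewrite ?mul1r ?mul0r.
Qed.

Lemma ointE p g x : 1 <= p -> Lp (conj_exp p) g ->
  oint g x = Rintegral mu setT (fun t => oint_kernel x t * g t).
Proof.
move=> p1 lg; have ig a b := Lp_conj_integrable p1 lg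
  (measurable_itv `]a, b]) (mu_itv_oc_lty a b).
rewrite /oint; case: (leP 0 x) => x0.
  by rewrite oint_kernel_ge0// -Rintegral_indicM -Rintegral_itv_obnd_cbnd.
rewrite (oint_kernel_le0 (ltW x0)) -Rintegral_itv_obnd_cbnd// Rintegral_indicM.
rewrite -[LHS]mulN1r -IntRZ//.
  by apply: eq_IntR => t; rewrite mulrA.
apply: (integrable_conj p1) lg => //.
exact: Lp_indic (mu_itv_oc_lty _ _).
Qed.

Lemma oint0 p g : 1 <= p -> Lp (conj_exp p) g -> oint g 0 = 0.
Proof.
move=> p1 lg; rewrite (ointE _ p1 lg).
rewrite (_ : (fun=> _) = (fun=> 0)) ?IntR0//.
by apply/funext => t; rewrite /oint_kernel subrr mul0r.
Qed.

Lemma ointD p g1 g2 : 1 <= p -> Lp (conj_exp p) g1 -> Lp (conj_exp p) g2 ->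
  oint (g1 \+ g2) = oint g1 \+ oint g2.
Proof.
move=> p1 l1 l2; apply/funext => x /=.
rewrite !(ointE _ p1)//; last by apply: LpD => //; exact: conj_exp_ge1.
have lk := Lp_oint_kernel x p1.
rewrite -IntRD//; try exact: (integrable_conj p1).
by apply: eq_IntR => t; rewrite /= mulrDr.
Qed.

Lemma ointZ p k g : 1 <= p -> Lp (conj_exp p) g ->
  oint (fun x => k * g x) = (fun x => k * oint g x).
Proof.
move=> p1 l1; apply/funext => x /=.
rewrite !(ointE _ p1)//; last by apply: LpZ => //; exact: conj_exp_ge1.
have lk := Lp_oint_kernel x p1.
rewrite -IntRZ//; try exact: (integrable_conj p1).
by apply: eq_IntR => t; rewrite /= mulrCA.
Qed.

(** Translating the density translates the primitive up to the constant that restores the value $0$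
    at the origin. *)
Lemma oint_transl p z g x : 1 <= p -> Lp (conj_exp p) g ->
  oint (transl z g) x = oint g (x - z) - oint g (- z).
Proof.
move=> p1 lg; have lt : Lp (conj_exp p) (transl z g).
  apply: Lp_preserving lg; first exact: conj_exp_ge1.
  exact: mu_preserving_shiftN.
rewrite !(ointE _ p1)//.
rewrite -IntRB//; try exact: (integrable_conj p1 (Lp_oint_kernel _ p1)).
have mk : measurable_fun setT (oint_kernel x) by case: (Lp_oint_kernel x p1).
rewrite -(@Rintegral_preserving _ _ _ (mu_preserving_shift z)); last first.
  by apply: measurable_funM => //; case: lt.
apply: eq_IntR => t.
rewrite -mulrBl /transl addrK; congr (_ * _).
(* After the substitution $t\mapsto t+z$ the two jumps of the kernel sit at $x-z$ and $-z$; on the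
   right-hand side the indicators of $t\le 0$ cancel. *)
rewrite /oint_kernel -!lerBrDr sub0r.
by rewrite opprB addrA subrK.
Qed.

(** All integrals of $g$ over intervals []a, b]] vanish, so the derivative of its primitive is $0$,
    and by Lebesgue differentiation it is $g$ almost everywhere. This is the uniqueness of the
    derivative in $I^q$. *)
Lemma oint_eq0_ae p g : 1 <= p -> Lp (conj_exp p) g -> oint g =1 (fun=> 0) ->
  {ae mu, forall x, g x = 0}.
Proof.
move=> p1 lg g0.
have F0 a b : Rintegral mu `]a, b] g = 0.
  case: (leP a b) => ab; last by rewrite set_itv_ge ?Rintegral_set0// bnd_simp -leNgt ltW.
  transitivity (oint g b - oint g a); last by rewrite !g0 subrr.
  rewrite !(ointE _ p1 lg) -IntRB//; try exact: (integrable_conj p1 (Lp_oint_kernel _ p1) lg).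
  rewrite Rintegral_indicM; apply: eq_IntR => t.
  rewrite -mulrBl; congr (_ * _); rewrite /oint_kernel opprB addrA subrK.
  rewrite indicE mem_setE in_itv/=; case: (leP t a) => ta /=.
    by rewrite (le_trans ta ab) subrr.
  by rewrite subr0.
have ig a y := Lp_conj_integrable p1 lg
  (measurable_itv `]a, y]) (mu_itv_oc_lty a y).
(* The differentiation theorem needs a left endpoint, so it is applied on the half-lines starting at
   $-n$; the countably many exceptional null sets are then merged. *)
have aen (n : nat) : {ae mu, forall x, - n%:R < x -> g x = 0}.
  apply: ae_imp (@FTC1 R g (BRight (- n%:R)) (ig _) (Lp_conj_locally_integrable p1 lg)).
  move=> x /= gx nx; have [] := gx nx => _ <-.
  rewrite (_ : (fun y => _) = cst 0) ?derive1_cst//.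
  by apply/funext => y; rewrite F0.
have /ae_foralln : forall n, {ae mu, forall x, - n%:R < x -> g x = 0} := aen.
apply: ae_imp => x gx; apply: (gx (Num.bound `|x|)).
rewrite ltrNl; apply: le_lt_trans (archi_boundP (normr_ge0 x)).
by rewrite -normrN ler_norm.
Qed.

Lemma Ider_ae p H h : 1 <= p -> Iq_with (conj_exp p) (fun x => H x - H 0) h ->
  Lp (conj_exp p) (Ider (conj_exp p) H) /\
  {ae mu, forall y, Ider (conj_exp p) H y = h y}.
Proof.
move=> p1 [lh hE]; rewrite /Ider; case: pselect => [P|]; last first.
  by move=> nP; exfalso; apply: nP; exists h.
case: (cid P) => h' [lh' h'E] /=; split => //.
have q1 := conj_exp_ge1 p1.
have lm : Lp (conj_exp p) (fun x => -1 * h x) by exact: LpZ.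
have /(oint_eq0_ae p1 (LpD q1 lh' lm)) : oint (h' \+ (fun x => -1 * h x)) =1 (fun=> 0).
  move=> x; rewrite (ointD p1)// (ointZ _ p1)//= -hE -h'E mulN1r.
  by rewrite subrr.
by apply: ae_imp => x /=; rewrite mulN1r => /eqP; rewrite subr_eq0 => /eqP.
Qed.

(** The minus sign of the distributional integral cancels the one in [refl_prim]. Asking only for
    $H-H(0)\in I^q$ lets the lemma serve constants, translates of $G$ and $G\ast h$ as well as
    $G$. *)
Lemma dconvE p F H h : 1 <= p -> Lp p%:E F ->
  Iq_with (conj_exp p) (fun x => H x - H 0) h -> dconv p F H = lconv F h.
Proof.
move=> p1 lF Hh; have [lI Ih] := Ider_ae p1 Hh; have [lh _] := Hh.
apply/funext => x; have px := mu_preserving_refl x.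
have p1e : (1 <= p%:E)%E by rewrite lee_fin.
have lFx : Lp p%:E (fun y => F (x - y)) by exact: Lp_preserving px lF.
rewrite /dconv /dint /lconv /refl_prim -mulN1r -IntRZ; last first.
  apply: (integrable_conj p1) lI.
  have := LpZ (-1) p1e lFx; congr Lp.
  by apply/funext => y; rewrite mulN1r.
have [mF _] := lFx; have [mh _] := lh; have [mI _] := lI.
apply: ae_eq_IntR.
- apply: measurable_funM => //; apply: measurable_funM => //.
  exact: measurable_funN.
- exact: measurable_funM.
- by apply: ae_imp Ih => y ->; rewrite mulN1r mulNr opprK.
Qed.

Lemma Iq_with_sub0 p H h : 1 <= p -> Iq_with (conj_exp p) H h ->
  Iq_with (conj_exp p) (fun x => H x - H 0) h.
Proof.
by move=> p1 [lh hE]; split=> // x; rewrite !hE (oint0 p1 lh) subr0.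
Qed.

Lemma dconv_IqE p F H h : 1 <= p -> Lp p%:E F ->
  Iq_with (conj_exp p) H h -> dconv p F H = lconv F h.
Proof. by move=> p1 lF Hh; apply: dconvE => //; exact: Iq_with_sub0. Qed.

(** * Lebesgue convolution of conjugate exponents: existence, symmetry, bounds, bilinearity,
    translations *)

Lemma Lp_refl p x F : 1 <= p -> Lp p%:E F -> Lp p%:E (fun y => F (x - y)).
Proof.
move=> p1 lF; apply: Lp_preserving (mu_preserving_refl x) lF.
by rewrite lee_fin.
Qed.

Lemma conv_exists_conj p F g x : 1 <= p -> Lp p%:E F -> Lp (conj_exp p) g ->
  conv_exists F g x.
Proof. by move=> p1 lF lg; exact: (integrable_conj p1 (Lp_refl x p1 lF) lg). Qed.

Lemma conv_exists_sym (u v : R -> R) x : conv_exists u v x -> conv_exists v u x.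
Proof.
move=> /(integrable_preserving (mu_preserving_refl x)).
by apply: eq_integrable => // y _ /=; rewrite subKr mulrC.
Qed.

Lemma lconv_sym (u v : R -> R) : measurable_fun setT u -> measurable_fun setT v ->
  lconv u v = lconv v u.
Proof.
move=> mu mv; apply/funext => x; rewrite /lconv.
rewrite -(Rintegral_preserving (mu_preserving_refl x)).
  by apply: eq_IntR => y; rewrite subKr mulrC.
apply: measurable_funM => //.
exact: measurable_preserving (mu_preserving_refl x) mu.
Qed.

Lemma lconv_le p F g x : 1 <= p -> Lp p%:E F -> Lp (conj_exp p) g ->
  (`|lconv F g x|%:E <= normp p%:E F * normp (conj_exp p) g)%E.
Proof.
move=> p1 lF lg; have [mF _] := lF.
rewrite -(normp_preserving p (mu_preserving_refl x) mF).
exact: Rintegral_conj_le (Lp_refl x p1 lF) lg.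
Qed.

Lemma normpy_lconv_le p F g : 1 <= p -> Lp p%:E F -> Lp (conj_exp p) g ->
  (normp +oo%E (lconv F g) <= normp p%:E F * normp (conj_exp p) g)%E.
Proof.
move=> p1 lF lg; rewrite normpyE; apply: ess_sup_ler => y.
exact: lconv_le.
Qed.

Lemma Lpy_of_le f (M : R) : measurable_fun setT f -> (forall x, `|f x| <= M) ->
  Lp +oo%E f.
Proof.
move=> mf fM; split=> //; rewrite /finite_norm.
apply: (@le_lt_trans _ _ M%:E); last exact: ltry.
apply: normpy_le; exact: aeW.
Qed.

Lemma lconvDl p F1 F2 g : 1 <= p -> Lp p%:E F1 -> Lp p%:E F2 ->
  Lp (conj_exp p) g -> lconv (F1 \+ F2) g = lconv F1 g \+ lconv F2 g.
Proof.
move=> p1 l1 l2 lg; apply/funext => x; rewrite /lconv /= -IntRD.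
- by apply: eq_IntR => y; rewrite /= mulrDl.
- exact: (conv_exists_conj x p1 l1 lg).
- exact: (conv_exists_conj x p1 l2 lg).
Qed.

Lemma lconvDr p F g1 g2 : 1 <= p -> Lp p%:E F -> Lp (conj_exp p) g1 ->
  Lp (conj_exp p) g2 -> lconv F (g1 \+ g2) = lconv F g1 \+ lconv F g2.
Proof.
move=> p1 lF l1 l2; apply/funext => x; rewrite /lconv /= -IntRD.
- by apply: eq_IntR => y; rewrite /= mulrDr.
- exact: (conv_exists_conj x p1 lF l1).
- exact: (conv_exists_conj x p1 lF l2).
Qed.

Lemma lconvZl p k F g : 1 <= p -> Lp p%:E F -> Lp (conj_exp p) g ->
  lconv (fun x => k * F x) g = (fun x => k * lconv F g x).
Proof.
move=> p1 lF lg; apply/funext => x; rewrite /lconv -IntRZ.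
  by apply: eq_IntR => y; rewrite mulrA.
exact: (conv_exists_conj x p1 lF lg).
Qed.

Lemma lconvZr p k F g : 1 <= p -> Lp p%:E F -> Lp (conj_exp p) g ->
  lconv F (fun x => k * g x) = (fun x => k * lconv F g x).
Proof.
move=> p1 lF lg; apply/funext => x; rewrite /lconv -IntRZ.
  by apply: eq_IntR => y; rewrite mulrCA.
exact: (conv_exists_conj x p1 lF lg).
Qed.

Lemma lconv_transl_l z (u v : R -> R) : lconv (transl z u) v = transl z (lconv u v).
Proof.
apply/funext => x; rewrite /lconv /transl; apply: eq_IntR => y.
by rewrite addrAC.
Qed.

Lemma lconv_transl_r z (u v : R -> R) :
  measurable_fun setT u -> measurable_fun setT v ->
  lconv u (transl z v) = transl z (lconv u v).
Proof.
move=> mu mv; apply/funext => x; rewrite /lconv /transl.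
rewrite -[LHS](Rintegral_preserving (mu_preserving_shift z)).
  by apply: eq_IntR => y; rewrite addrK opprD addrA addrAC.
apply: measurable_funM.
  exact: measurable_preserving (mu_preserving_refl x) mu.
exact: measurable_preserving (mu_preserving_shiftN z) mv.
Qed.

End hoelder_pairing.

(** * Continuity of translations *)

Section translation_continuity.
Context {R : realType}.
Local Notation mu := (@lebesgue_measure R).
Implicit Types (p M N e x a : R) (u f g F : R -> R).

Lemma ge0_le_IntT (f1 f2 : R -> \bar R) : (forall y, 0 <= f1 y)%E ->
  measurable_fun setT f1 -> measurable_fun setT f2 ->
  (forall y, f1 y <= f2 y)%E -> (\int[mu]_y f1 y <= \int[mu]_y f2 y)%E.
Proof. by move=> f10 m1 m2 f12; exact: ge0_le_integral. Qed.

(** A continuous $h$ approximates $u$ in $L^1$ on a compact interval, and $u(y+a)-u(y)$ is split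
    through $h(y+a)$ and $h(y)$ into three terms, each of integral at most $e/3$. *)
Lemma L1_translation_small u M N e : measurable_fun setT u -> 0 <= N ->
  (forall y, `|u y| <= M) -> (forall y, N < `|y| -> u y = 0) -> 0 < e ->
  \forall a \near (0 : R), (\int[mu]_y `|u (y + a) - u y|%:E <= e%:E)%E.
Proof.
move=> mfu N0 uM uN e0.
(* The margin $2$ beyond the support keeps both $y$ and $y+a$ in [E] when $|y|\le N+1$ and $|a|\le
   1$. *)
pose E : set R := `[- (N + 2), N + 2]%classic.
have mE : measurable E by exact: measurable_itv.
have muE : mu E = (2 * (N + 2))%:E.
  rewrite lebesgue_measure_itv/= lte_fin ifT; last by lra.
  by rewrite -EFinB; congr (_%:E); lra.
have Eoo : (mu E < +oo)%E by rewrite muE ltry.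
have uint : mu.-integrable E (EFin \o u).
  apply: measurable_bounded_integrable => //; first exact: measurable_funTS.
  exists M; split; rewrite ?num_real// => x Mx y _ /=.
  exact: le_trans (uM y) (ltW Mx).
have [g_ [cg ig /fine_cvgP[gfin gcvg]]] := approximation_continuous_integrable mE Eoo uint.
have e3 : 0 < e / 3 by lra.
have [h ch hE] : exists2 h : R -> R, continuous h &
    (\int[mu]_(z in E) `|(u z - h z)%:E| <= (e / 3)%:E)%E.
  have [n _] : \forall n \near \oo, (\int[mu]_(z in E) `|(u z - g_ n z)%:E| <= (e / 3)%:E)%E.
    move/cvgrPdist_le : gcvg => /(_ _ e3) gcvg.
    near=> n.
    have gf : (\int[mu]_(z in E) `|(u z - g_ n z)%:E| \is a fin_num)%E by near: n.
    rewrite -(fineK gf) lee_fin.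
    have : `|0 - fine (\int[mu]_(z in E) `|(u z - g_ n z)%:E|)%E| <= e / 3 by near: n.
    by rewrite sub0r normrN; apply: le_trans; exact: ler_norm.
  by move=> /(_ n (leqnn n)) gn; exists (g_ n).
(* Chosen so that [c] times the measure of [E] is $e/3$. *)
pose c := e / 3 / (2 * (N + 2)).
have c0 : 0 < c by rewrite divr_gt0//; lra.
have mh : measurable_fun [set: R] h by exact: continuous_measurable_fun.
have cE : compact E by exact: segment_compact.
(* Uniformity over [E] comes from compactness: near each $x$, balls of radius $d/2$ keep $y$ and
   $y+a$ within $d$ of $x$, where [h] varies by at most $c/2$. *)
have hc : \forall a \near (0 : R), forall y, E y -> `|h (y + a) - h y| <= c.
  move/compact_near_coveringP : cE => /(_ R (nbhs (0 : R)) (fun a y => `|h (y + a) - h y| <= c) _).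
  apply => x Ex /=.
  have c2 : 0 < c / 2 by lra.
  have hx := ch x; move/cvgrPdist_le : hx => /(_ _ c2) [d /= d0 hd].
  have d2 : 0 < d / 2 by rewrite divr_gt0.
  exists (ball x (d / 2), ball 0 (d / 2)) => /=.
    by split; exact: nbhsx_ballx.
  move=> [y a] /= []; rewrite /ball/= sub0r normrN => xy a2.
  have h1 : `|h x - h y| <= c / 2.
    by apply: hd; rewrite /ball_ /=; apply: lt_le_trans xy _; lra.
  have h2 : `|h x - h (y + a)| <= c / 2.
    apply: hd; rewrite /ball_ /= opprD addrA.
    by apply: le_lt_trans (ler_normB _ _) _; lra.
  rewrite -(subrKA (h x)) addrC; apply: le_trans (ler_normD _ _) _.
  by rewrite (distrC (h _) (h x)); lra.
(* The error is cut off to [E] because [h] approximates [u] only there; the function on all of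
   $\mathbb R$ can then be translated. *)
pose D (y : R) : \bar R := (\1_E y * `|u y - h y|)%:E.
have mD : measurable_fun [set: R] D.
  apply/measurable_EFinP; apply: measurable_funM; first exact: measurable_indic.
  by apply: measurableT_comp => //; exact: measurable_funB.
have D0 y : (0 <= D y)%E by rewrite lee_fin mulr_ge0.
have DE : (\int[mu]_y D y <= (e / 3)%:E)%E.
  apply: le_trans hE; rewrite [leRHS]integral_mkcond le_eqVlt; apply/orP; left; apply/eqP.
  apply: eq_integral => y _; rewrite patchE /D indicE.
  by case: (_ \in _); rewrite ?mul1r ?mul0r.
near=> a.
have ha : forall y, E y -> `|h (y + a) - h y| <= c by near: a; exact: hc.
have a1 : `|a| <= 1.
  near: a; exists 1 => //= a; rewrite /ball_ /= sub0r normrN; exact: ltW.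
have pa := mu_preserving_shift a.
have mDa : measurable_fun [set: R] (fun y => D (y + a)).
  by case: pa => mphi _; exact: (measurableT_comp mD mphi).
have mcE : measurable_fun [set: R] (fun y => (c * \1_E y)%:E).
  by apply/measurable_EFinP; apply: measurable_funM => //; exact: measurable_indic.
have cE0 y : (0 <= (c * \1_E y)%:E)%E by rewrite lee_fin mulr_ge0// ltW.
have icE : (\int[mu]_y (c * \1_E y)%:E = (e / 3)%:E)%E.
  under eq_integral do rewrite EFinM.
  rewrite ge0_integralZl//; last 2 first.
  - by apply/measurable_EFinP; exact: measurable_indic.
  - by rewrite lee_fin ltW.
  transitivity (c%:E * mu E)%E; first by rewrite integral_indic// setIT.
  rewrite muE -EFinM /c; congr (_%:E).
  by rewrite divfK// gt_eqF//; lra.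
apply: (@le_trans _ _ (\int[mu]_y (D (y + a)%R + ((c * \1_E y)%:E + D y)))%E).
  apply: ge0_le_IntT => //.
  - apply/measurable_EFinP; apply: measurableT_comp => //.
    by apply: measurable_funB => //; exact: measurable_preserving pa mfu.
  - by apply: emeasurable_funD => //; exact: emeasurable_funD.
  (* Beyond $N+1$ both $u(y)$ and $u(y+a)$ vanish, since $|y+a|>N$; otherwise the three-term
     triangle inequality holds with both points in [E]. *)
  - move=> y; case: (leP `|y| (N + 1)) => yN.
      have Ey : y \in E.
        by rewrite inE /E /= in_itv/= -ler_norml; lra.
      have Eya : y + a \in E.
        rewrite inE /E /= in_itv/= -ler_norml.
        by apply: le_trans (ler_normD _ _) _; lra.
      rewrite /D !indicE Ey Eya /= mulr1 !mul1r -!EFinD lee_fin.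
      have := ha y (set_mem Ey).
      have -> : u (y + a) - u y = (u (y + a) - h (y + a)) + ((h (y + a) - h y) + (h y - u y)).
        by lra.
      move=> hay; apply: le_trans (ler_normD _ _) _; rewrite lerD2l.
      by apply: le_trans (ler_normD _ _) _; rewrite (distrC (h y)) lerD2r.
    have -> : u y = 0 by apply: uN; lra.
    have -> : u (y + a) = 0.
      apply: uN; have := ler_normD (y + a) (- a); rewrite addrK normrN; lra.
    by rewrite subrr normr0 !adde_ge0.
rewrite ge0_integralD//; last 2 first.
- by move=> y _; rewrite adde_ge0.
- exact: emeasurable_funD.
rewrite ge0_integralD// icE (ge0_integral_preserving pa)//.
apply: le_trans (leeD DE (leeD (lexx _) DE)) _.
by rewrite -!EFinD lee_fin; lra.
Unshelve. all: by end_near. Qed.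

Lemma normp_le_powR p u e : 1 <= p -> 0 <= e ->
  (\int[mu]_y (`|u y| `^ p)%:E <= (e `^ p)%:E)%E -> (normp p%:E u <= e%:E)%E.
Proof.
move=> p1 e0 ue; have p0 : 0 < p by rewrite (lt_le_trans ltr01).
have -> : e%:E = ((e `^ p)%:E `^ p^-1)%E.
  by rewrite poweR_EFin -powRrM divff ?powRr1// gt_eqF.
rewrite /normp unlock; apply: gt0_ler_poweR.
- by rewrite invr_ge0 ltW.
- by rewrite in_itv/= leey andbT integral_ge0// => y _; rewrite poweR_ge0.
- by rewrite in_itv/= leey andbT lee_fin powR_ge0.
- exact: ue.
Qed.

Lemma measurable_norm_powR p u : measurable_fun setT u ->
  measurable_fun setT (fun y => `|u y| `^ p).
Proof.
move=> mfu; apply: (@measurableT_comp _ _ _ _ _ _ (@powR R ^~ p)) => //.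
exact: measurableT_comp.
Qed.

(** Since $|u|^p=|u|^{p-1}|u|$ and $|u|\le M$, smallness in $L^1$ passes to $L^p$ for bounded
    functions. *)
Lemma integral_powR_le p u M : 1 <= p -> measurable_fun setT u ->
  (forall y, `|u y| <= M) ->
  (\int[mu]_y (`|u y| `^ p)%:E <= (M `^ (p - 1))%:E * \int[mu]_y `|u y|%:E)%E.
Proof.
move=> p1 mfu uM; rewrite -ge0_integralZl//; last 2 first.
- by apply/measurable_EFinP; exact: measurableT_comp.
- by rewrite lee_fin powR_ge0.
apply: ge0_le_IntT.
- by move=> y; rewrite lee_fin powR_ge0.
- by apply/measurable_EFinP; exact: measurable_norm_powR.
- apply: emeasurable_funM => //; apply/measurable_EFinP; exact: measurableT_comp.
- move=> y; rewrite -EFinM lee_fin -mulr_powRB1//; last by rewrite (lt_le_trans ltr01).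
  rewrite mulrC ler_wpM2r//; apply: ge0_ler_powR; rewrite ?nnegrE ?subr_ge0//.
  exact: le_trans (uM y).
Qed.

(** Cutting $F$ to the set where both $|F(y)|\le n$ and $|y|\le n$ gives a pointwise limit, and
    $|F|^p$ dominates the error; a single integer bounds values and support. *)
Lemma Lp_truncation p F e : 1 <= p -> Lp p%:E F -> 0 < e ->
  exists u N, [/\ measurable_fun setT u, 0 <= N, forall y, `|u y| <= N,
    forall y, N < `|y| -> u y = 0 & (normp p%:E (F \- u)%R <= e%:E)%E].
Proof.
move=> p1 lF e0; have [mF _] := lF; have p0 : 0 < p by rewrite (lt_le_trans ltr01).
pose A (n : nat) : set R := [set y | `|F y| <= n%:R] `&` `[- n%:R, n%:R]%classic.
have mA n : measurable (A n).
  apply: measurableI; last exact: measurable_itv.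
  rewrite (_ : [set _ | _] = (fun y => `|F y|) @^-1` `]-oo, n%:R]%classic); last first.
    by apply/seteqP; split => y /=; rewrite in_itv.
  rewrite -[X in measurable X]setTI.
  have : measurable_fun [set: R] (fun y => `|F y|) by exact: measurableT_comp.
  by apply => //; exact: measurable_itv.
pose u (n : nat) (y : R) := \1_(A n) y * F y.
have mfu n : measurable_fun setT (u n).
  by apply: measurable_funM => //; exact: measurable_indic.
pose f_ (n : nat) (y : R) : \bar R := (`|F y - u n y| `^ p)%:E.
have mf_ n : measurable_fun setT (f_ n).
  by apply/measurable_EFinP; apply: measurable_norm_powR; exact: measurable_funB.
(* For fixed $y$ the sequence is eventually constant: once $y\in A_n$ the term is $0^p$, which is
   $0$ because $p>0$. *)
have fcvg (y : R) : f_ ^~ y @ \oo --> (0%E : \bar R).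
  apply: cvg_near_cst; near=> n; rewrite /f_ /u indicE mem_set ?mul1r ?subrr ?normr0.
    by rewrite powR0// gt_eqF.
  split => /=.
    by near: n; exact: nbhs_infty_ger.
  rewrite in_itv/= -ler_norml.
  by near: n; exact: nbhs_infty_ger.
have ig : mu.-integrable setT (fun y => (`|F y| `^ p)%:E).
  by apply: Lfun_integrable => //; exact/LpP.
have : (\int[mu]_y f_ n y)%E @[n --> \oo] --> (0%E : \bar R).
  have [] := @dominated_convergence _ _ R mu setT measurableT f_ (cst 0%E)
    (fun y => (`|F y| `^ p)%:E).
  - by move=> n; exact: mf_.
  - exact: measurable_cst.
  - by apply: aeW => y _; exact: fcvg.
  - exact: ig.
  - apply: aeW => y n _; rewrite /f_ /= lee_fin ger0_norm ?powR_ge0//.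
    apply: ge0_ler_powR; rewrite ?nnegrE//; first exact: ltW.
    rewrite /u indicE; case: (_ \in _); rewrite ?mul1r ?mul0r ?subr0//.
    by rewrite subrr normr0.
  - by move=> _ _; rewrite integral0.
move=> /fine_cvgP[].
have ep0 : 0 < e `^ p by exact: powR_gt0.
move=> ffin /cvgrPdist_le /(_ _ ep0) fe.
have [n _] : \forall n \near \oo, (\int[mu]_y f_ n y <= (e `^ p)%:E)%E.
  near=> n.
  have gf : (\int[mu]_y f_ n y \is a fin_num)%E by near: n.
  rewrite -(fineK gf) lee_fin.
  have : `|0 - fine (\int[mu]_y f_ n y)%E| <= e `^ p by near: n.
  by rewrite sub0r normrN; apply: le_trans; exact: ler_norm.
move=> /(_ n (leqnn n)) fn; exists (u n), n%:R; split => //.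
- move=> y; rewrite /u indicE; case: (boolP (y \in A n)) => [|_]; last by rewrite mul0r normr0.
  by rewrite inE mul1r => -[].
- move=> y ny; rewrite /u indicE memNset ?mul0r// => -[_] /=.
  by rewrite in_itv/= -ler_norml leNgt ny.
- exact: (normp_le_powR p1 (ltW e0)).
Unshelve. all: by end_near. Qed.

Lemma normpD p f g : 1 <= p -> measurable_fun setT f -> measurable_fun setT g ->
  (normp p%:E (f \+ g)%R <= normp p%:E f + normp p%:E g)%E.
Proof. by move=> p1 mf mg; exact: minkowski_EFin. Qed.

Lemma normp_distC p f g : normp p%:E (f \- g) = normp p%:E (g \- f).
Proof.
rewrite /normp -[RHS]oppe_Lnorm; apply: eq_Lnorm => y /=.
by rewrite opprB.
Qed.

Lemma Lp_translation_small p F e : 1 <= p -> Lp p%:E F -> 0 < e ->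
  \forall a \near (0 : R), (normp p%:E (fun y => (F (y + a) - F y)%R) <= e%:E)%E.
Proof.
move=> p1 lF e0; have [mF _] := lF; have p0 : 0 < p by rewrite (lt_le_trans ltr01).
have e3 : 0 < e / 3 by lra.
have [u [N [mfu N0 uN uN0 Fu]]] := Lp_truncation p1 lF e3.
(* The difference $u(y+a)-u(y)$ is bounded by $2N$, so its $L^1$ norm is multiplied by at most
   $(2N)^{p-1}$; adding $1$ makes the later division legitimate. *)
pose K := (N + N) `^ (p - 1) + 1.
have K0 : 0 < K by rewrite ltr_wpDl// powR_ge0.
have d0 : 0 < (e / 3) `^ p / K by rewrite divr_gt0// powR_gt0.
have mFu : measurable_fun setT (F \- u) by exact: measurable_funB.
near=> a; have pa := mu_preserving_shift a.
have ua : (\int[mu]_y `|u (y + a) - u y|%:E <= ((e / 3) `^ p / K)%:E)%E.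
  by near: a; exact: (L1_translation_small mfu N0 uN uN0 d0).
pose v (y : R) := u (y + a) - u y.
have mv : measurable_fun setT v.
  by apply: measurable_funB => //; exact: measurable_preserving pa mfu.
have v3 : (normp p%:E v <= (e / 3)%:E)%E.
  apply: (normp_le_powR p1 (ltW e3)).
  apply: le_trans (@integral_powR_le _ _ (N + N) p1 mv _) _.
    by move=> y; apply: le_trans (ler_normB _ _) _; exact: lerD.
  apply: (@le_trans _ _ (K%:E * ((e / 3) `^ p / K)%:E)%E).
    apply: lee_pmul => //.
    + by rewrite lee_fin powR_ge0.
    + exact: integral_ge0.
    + by rewrite lee_fin /K lerDl.
  by rewrite -EFinM lee_fin mulrCA divff ?mulr1// gt_eqF.
have mFa : measurable_fun setT (fun y : R => (F \- u) (y + a)).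
  exact: measurable_preserving pa mFu.
have mNF : measurable_fun setT (u \- F) by exact: measurable_funB.
rewrite (_ : (fun y => _) = (fun y : R => (F \- u) (y + a)) \+ (v \+ (u \- F))); last first.
  by apply/funext => y; rewrite /v /=; lra.
apply: le_trans (normpD p1 mFa (measurable_funD mv mNF)) _.
apply: le_trans (leeD (lexx _) (normpD p1 mv mNF)) _.
rewrite (normp_distC p u F) (normp_preserving p pa mFu).
apply: le_trans (leeD Fu (leeD v3 Fu)) _.
by rewrite -!EFinD lee_fin; lra.
Unshelve. all: by end_near. Qed.

(** The difference of two values of $F\ast g$ is a single value of the convolution of $g$ with
    $F(\cdot+a)-F$, where $a=x-x'$, so Hoelder bounds it by a quantity depending on $a$ only. *)
Lemma unif_continuous_lconv p F g : 1 <= p -> Lp p%:E F -> Lp (conj_exp p) g ->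
  unif_continuous (lconv F g).
Proof.
move=> p1 lF lg; have [mF _] := lF.
have p1e : (1 <= p%:E)%E by rewrite lee_fin.
apply/unif_continuousP => /= e e0.
pose K := fine (normp (conj_exp p) g) + 1.
have K0 : 0 < K by rewrite ltr_wpDl// fine_ge0// normp_ge0.
(* Since [K] dominates the norm of [g], the final bound is $e/2$; the factor $1/2$ supplies the
   strict inequality. *)
have d0 : 0 < e / K / 2 by rewrite !divr_gt0.
have [d /= dp dF] := Lp_translation_small p1 lF d0.
exists d => // -[x x'] /= xx'.
pose a := x - x'; pose H (y : R) := F (y + a) - F y.
have pa := mu_preserving_shift a.
have lH : Lp p%:E H by apply: LpB => //; exact: Lp_preserving pa lF.
have He : (normp p%:E H <= (e / K / 2)%:E)%E.
  by apply: dF; rewrite /ball_ /= sub0r normrN.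
rewrite /ball/=; have -> : lconv F g x - lconv F g x' = lconv H g x'.
  rewrite /lconv -IntRB.
  - apply: eq_IntR => y; rewrite -mulrBl /H /a; congr ((F _ - F _) * _).
    by lra.
  - exact: (conv_exists_conj x p1 lF lg).
  - exact: (conv_exists_conj x' p1 lF lg).
rewrite -lte_fin; apply: le_lt_trans (lconv_le x' p1 lH lg) _.
apply: (@le_lt_trans _ _ ((e / K / 2)%:E * K%:E)%E).
  apply: lee_pmul => //; try exact: normp_ge0.
  by rewrite (Lp_fine lg) lee_fin /K lerDl.
by rewrite -EFinM lte_fin mulrAC divfK ?gt_eqF//; lra.
Qed.

Lemma continuous_lconv p F g : 1 <= p -> Lp p%:E F -> Lp (conj_exp p) g ->
  continuous (lconv F g).
Proof.
move=> p1 lF lg x; apply/cvg_ballP => e e0.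
have /unif_continuousP /(_ e e0) [d d0 dF] := unif_continuous_lconv p1 lF lg.
by exists d => // y xy; exact: (dF (x, y)).
Qed.

Lemma Lpy_lconv p F g : 1 <= p -> Lp p%:E F -> Lp (conj_exp p) g ->
  Lp +oo%E (lconv F g).
Proof.
move=> p1 lF lg.
apply: (@Lpy_of_le _ _ (fine (normp p%:E F) * fine (normp (conj_exp p) g))).
  by apply: continuous_measurable_fun; exact: continuous_lconv lg.
move=> x; rewrite -lee_fin EFinM -(Lp_fine lF) -(Lp_fine lg).
exact: lconv_le.
Qed.

(** If $|f(x)|$ exceeded the essential supremum, it would do so on a whole ball around $x$ by
    continuity, and that ball would lie in a null set. *)
Lemma continuous_le_normpy f x : continuous f -> (`|f x|%:E <= normp +oo%E f)%E.
Proof.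
move=> cf; rewrite leNgt; apply/negP => fx.
pose U : set R := (fun y => `|f y|%:E) @^-1` [set z | (normp +oo%E f < z)%E].
have nU : nbhs x U.
  have [r [fr rx]] : exists r : R, (normp +oo%E f <= r%:E)%E /\ r < `|f x|.
    exists (fine (normp +oo%E f)).
    have fn : normp +oo%E f \is a fin_num.
      by rewrite ge0_fin_numE ?normp_ge0//; apply: lt_trans fx (ltry _).
    by rewrite fineK//; split => //; rewrite -lte_fin fineK.
  have : \forall y \near x, r < `|f y|.
    have cn : (fun y => `|f y|) @ x --> `|f x| by apply: cvg_norm; exact: cf.
    exact: (cvgr_gt _ cn).
  apply: filterS => y ry; rewrite /U /=; apply: le_lt_trans fr _.
  by rewrite lte_fin.
have [N [mN N0 fN]] := ess_sup_ge mu (fun y => `|f y|%:E).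
have UN : U `<=` N.
  by move=> y Uy; apply: fN => /= ; rewrite -normpyE; apply/negP; rewrite -ltNge.
case: nU => d /= d0 dU.
have : (mu (ball x d) <= mu N)%E.
  apply: le_measure; rewrite ?inE//; first exact: measurable_ball.
  by move=> y xy; apply: UN; apply: dU.
rewrite N0 lebesgue_measure_ball; last exact: ltW.
by rewrite leNgt lte_fin mulrn_wgt0.
Qed.

End translation_continuity.

(** * Operator norms and supports *)

Section extremizer.
Context {R : realType}.
Local Notation mu := (@lebesgue_measure R).
Implicit Types (p e x a : R) (u v f g F : R -> R).

Lemma measurable_sgr u : measurable_fun setT u ->
  measurable_fun setT (fun y => Num.sg (u y)).
Proof.
move=> mfu; pose P : set R := u @^-1` `]0, +oo[%classic.
pose Q : set R := u @^-1` `]-oo, 0[%classic.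
have mP : measurable P.
  by rewrite -[X in measurable X]setTI; apply: mfu => //; exact: measurable_itv.
have mQ : measurable Q.
  by rewrite -[X in measurable X]setTI; apply: mfu => //; exact: measurable_itv.
rewrite (_ : (fun y => _) = \1_P \- \1_Q); last first.
  apply/funext => y /=; rewrite !indicE.
  have -> : (y \in P) = (0 < u y).
    by apply/idP/idP; rewrite inE /P/= in_itv/= andbT.
  have -> : (y \in Q) = (u y < 0) by apply/idP/idP; rewrite inE /Q/= in_itv.
  case: (ltgtP (u y) 0) => uy.
  - by rewrite ltr0_sg// sub0r.
  - by rewrite gtr0_sg// subr0.
  - by rewrite uy sgr0 subrr.
by apply: measurable_funB; exact: measurable_indic.
Qed.

(** Equality in Hoelder's inequality: the sign of $u$ for $p=1$, and
    $\mathrm{sgn}(u)(|u|/\|u\|_p)^{p-1}$ for $p>1$. *)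
Lemma conj_extremizer p u : 1 <= p -> Lp p%:E u ->
  exists v, [/\ Lp (conj_exp p) v, (normp (conj_exp p) v <= 1)%E &
    Rintegral mu setT (fun y => u y * v y) = fine (normp p%:E u)].
Proof.
rewrite le_eqVlt => /predU1P[<-|p1] lu; have [mfu _] := lu.
  rewrite conj_exp1; exists (fun y => Num.sg (u y)).
  have s1 y : `|Num.sg (u y)| <= 1 by rewrite normr_sg; case: (_ != 0).
  split.
  - exact: Lpy_of_le (measurable_sgr mfu) s1.
  - by apply: normpy_le; exact: aeW.
  - rewrite /normp Lnorm1; congr fine; apply: eq_integral => y _.
    by rewrite /= normrEsg mulrC.
have p0 : 0 < p by rewrite (lt_trans ltr01).
have q1 := conj_exp_gt1 p1; rewrite conj_expE//; set q := p / (p - 1) in q1 *.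
have q1e : (1 <= q%:E)%E by rewrite lee_fin ltW.
pose N := fine (normp p%:E u).
(* The normalisation by [N] needs $N\ne0$; when $N=0$ the witness $v=0$ already gives the value
   $0$. *)
have [N0|N0] := eqVneq N 0.
  exists (fun=> 0); split; first exact: Lp0.
    rewrite (_ : normp _ _ = 0%E) ?lee01//; apply: Lnorm0.
    by rewrite gt_eqF// lte_fin (lt_trans ltr01).
  rewrite -/N N0 -[RHS]IntR0; apply: eq_IntR => y; by rewrite mulr0.
have Np : 0 < N by rewrite lt_def N0 fine_ge0// normp_ge0.
pose w (y : R) := `|u y| / N.
have w0 y : 0 <= w y by rewrite divr_ge0// ltW.
have mw : measurable_fun setT w.
  by apply: measurable_funM => //; exact: measurableT_comp.
have iu : (\int[mu]_y (`|u y| `^ p)%:E = (N `^ p)%:E)%E.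
  have := @powR_Lnorm _ _ R mu (EFin \o u) p; rewrite gt_eqF// => /(_ isT) <-.
  by rewrite -/(normp _ _) (Lp_fine lu).
have iup : mu.-integrable setT (fun y => (`|u y| `^ p)%:E).
  by apply: Lfun_integrable; [exact: ltW|exact/LpP].
have wE y : w y `^ p = (N `^ p)^-1 * `|u y| `^ p.
  rewrite /w powRM// ?invr_ge0 ?(ltW Np)// mulrC -powR_inv1 ?(ltW Np)//.
  by rewrite powRAC powR_inv1// powR_ge0.
have iw : (\int[mu]_y (w y `^ p)%:E = 1)%E.
  under eq_integral do rewrite wE EFinM.
  rewrite integralZl// iu -EFinM mulVf// gt_eqF// powR_gt0//.
have iwp : mu.-integrable setT (fun y => (w y `^ p)%:E).
  apply: eq_integrable (integrableZl measurableT (N `^ p)^-1 iup) => // y _.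
  by rewrite wE EFinM.
pose v (y : R) := Num.sg (u y) * w y `^ (p - 1).
have mwp r : measurable_fun setT (fun y => w y `^ r).
  exact: (@measurableT_comp _ _ _ _ _ _ (@powR R ^~ r)).
have mv : measurable_fun setT v.
  by apply: measurable_funM; [exact: measurable_sgr|exact: mwp].
(* Here $(p-1)q=p$. At zeros of [u] the sign is $0$, and so is $w^{p-1}$ because $p>1$. *)
have vE y : `|v y| `^ q = w y `^ p.
  have -> : `|v y| = w y `^ (p - 1).
    rewrite /v normrM normr_sg ger0_norm ?powR_ge0//.
    have [uy|uy] := eqVneq (u y) 0; last by rewrite mul1r.
    by rewrite /w uy normr0 (mul0r N^-1) powR0 ?mulr0// subr_eq0 gt_eqF.
  by rewrite -powRrM /q mulrCA divff ?mulr1// subr_eq0 gt_eqF.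
have nv : (normp q%:E v <= 1)%E.
  apply: (normp_le_powR (ltW q1)) => //; rewrite powR1.
  by under eq_integral do rewrite vE; rewrite iw.
exists v; split => //.
  by split => //; exact: le_lt_trans nv (ltry _).
have -> : Rintegral mu setT (fun y => u y * v y) = Rintegral mu setT (fun y => N * w y `^ p).
  apply: eq_IntR => y; rewrite -mulr_powRB1// /v mulrA mulrA; congr (_ * _).
  by rewrite /w mulrCA divff// mulr1 mulrC -normrEsg.
rewrite IntRZ; last exact: iwp.
by rewrite /Rintegral iw /= mulr1.
Qed.

(** At the origin the convolution pairs $v$ with the reflection $y\mapsto u(-y)$, whose norm is that
    of $u$; the extremizer is taken for this reflection. *)
Lemma lconv0_extremizer p u : 1 <= p -> Lp p%:E u ->
  exists v, [/\ Lp (conj_exp p) v, (normp (conj_exp p) v <= 1)%E &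
    lconv u v 0 = fine (normp p%:E u)].
Proof.
move=> p1 lu; have [mfu _] := lu.
have [v [lv nv uv]] := conj_extremizer p1 (Lp_refl 0 p1 lu); exists v; split=> //.
by rewrite -[LHS]/(Rintegral mu setT (fun y => u (0 - y) * v y)) uv
  (normp_preserving p (mu_preserving_refl 0) mfu).
Qed.

Lemma opnorm_PhiE p F : 1 <= p -> Lp p%:E F -> opnorm_Phi p F = normp p%:E F.
Proof.
move=> p1 lF; have Iq v : Lp (conj_exp p) v -> Iq_with (conj_exp p) (oint v) v by [].
apply/eqP; rewrite eq_le; apply/andP; split.
  apply: ge_ereal_sup => _ [v [lv nv] <-].
  rewrite (dconv_IqE p1 lF (Iq v lv)).
  apply: le_trans (normpy_lconv_le p1 lF lv) _.
  rewrite -[leRHS]mule1; apply: lee_pmul => //; exact: normp_ge0.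
have [v [lv nv uv]] := lconv0_extremizer p1 lF.
apply: le_trans (ereal_sup_ubound _); last by exists v.
rewrite (dconv_IqE p1 lF (Iq v lv)).
apply: le_trans (continuous_le_normpy 0 (continuous_lconv p1 lF lv)).
by rewrite uv (Lp_fine lF) lee_fin ler_norm.
Qed.

Lemma opnorm_Psi_le p G g : 1 <= p -> Iq_with (conj_exp p) G g ->
  (opnorm_Psi p G <= normp (conj_exp p) g)%E.
Proof.
move=> p1 Gg; have [lg _] := Gg; apply: ge_ereal_sup => _ [F [lF nF] <-].
rewrite (dconv_IqE p1 lF Gg).
apply: le_trans (normpy_lconv_le p1 lF lg) _.
rewrite -[leRHS]mul1e; apply: lee_pmul => //; exact: normp_ge0.
Qed.

(** The roles are exchanged: the extremizer is built for $g$ at the finite exponent $q>1$, lies in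
    $L^p$ because conjugation is an involution, and enters through symmetry of the convolution. For
    $p=1$ the exponent of $g$ is infinite and [conj_extremizer] does not apply. *)
Lemma opnorm_PsiE p G g : 1 < p -> Iq_with (conj_exp p) G g ->
  opnorm_Psi p G = normp (conj_exp p) g.
Proof.
move=> p1 Gg; have [lg _] := Gg; have p1' := ltW p1.
apply/eqP; rewrite eq_le opnorm_Psi_le//=.
have q1 := ltW (conj_exp_gt1 p1).
have lg' := lg; rewrite conj_expE// in lg'.
have [F []] := lconv0_extremizer q1 lg'.
rewrite conj_expK// => lF nF gF.
apply: le_trans (ereal_sup_ubound _); last by exists F.
rewrite (dconv_IqE p1' lF Gg).
apply: le_trans (continuous_le_normpy 0 (continuous_lconv p1' lF lg)).
have [mF _] := lF; have [mg _] := lg.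
rewrite (lconv_sym mF mg) gF conj_expE// (Lp_fine lg').
by rewrite lee_fin ler_norm.
Qed.

(** The complement of the essential support is a possibly uncountable union of open sets on which
    $f$ vanishes a.e.; intervals with rational endpoints reduce it to a countable one. *)
Lemma esupp_ae f : {ae mu, forall x, ~ esupp f x -> f x = 0}.
Proof.
pose null (a b : R) := {ae mu, forall x, x \in `]a, b[ -> f x = 0}.
(* The integer codes a pair of rationals. The condition is vacuous on intervals where [f] is not
   a.e. zero, so it holds a.e. for every code. *)
pose P (n : nat) (x : R) := match @unpickle (rat * rat)%type n with
  | Some (a, b) => null (ratr a) (ratr b) -> x \in `]ratr a, ratr b[ -> f x = 0
  | None => True end.
have : forall n, {ae mu, forall x, P n x}.
  move=> n; rewrite /P; case: unpickle => [[a b]|]; last exact: aeW.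
  have [ab|ab] := pselect (null (ratr a) (ratr b)); last by exact: aeW.
  by apply: ae_imp ab => x fx _.
move=> /ae_foralln; apply: ae_imp => x Px.
rewrite /esupp /setC /= => /contrapT [U [oU U0] Ux].
have [d /= d0 dU] : nbhs x U by exact: open_nbhs_nbhs.
have [a] := @rat_in_itvoo R (x - d) x (ltac:(lra)).
have [b] := @rat_in_itvoo R x (x + d) (ltac:(lra)).
rewrite !in_itv/= => /andP[xb bd] /andP[da ax].
have := Px (pickle (a, b)); rewrite /P pickleK; apply; last by rewrite in_itv/= ax.
apply: ae_imp U0 => y Uy; rewrite in_itv/= => /andP[ay yb]; apply: Uy.
by apply: dU; rewrite /ball_ /= ltr_distl; lra.
Qed.

(** If $y$ lies outside the closed sumset, then $y=(y-t)+t$ forces $F(y-t)=0$ or $g(t)=0$ for almost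
    every $t$, so $F\ast g$ vanishes at every point of an open set. *)
Lemma esupp_lconv F g : measurable_fun setT F -> measurable_fun setT g ->
  esupp (lconv F g) `<=` closure (minksum (esupp F) (esupp g)).
Proof.
move=> mF mg; set S := minksum _ _.
move=> x sx; apply: contrapT => nx; apply: sx; exists (~` closure S) => //; split.
  by apply: closed_openC; exact: closed_closure.
apply: aeW => y nSy; rewrite /lconv -[RHS]IntR0; apply: ae_eq_IntR.
- by apply: measurable_funM => //; exact: measurable_preserving (mu_preserving_refl y) mF.
- exact: measurable_cst.
have Fy := ae_preserving (mu_preserving_refl y) (esupp_ae F).
apply: ae_imp (ae_and Fy (esupp_ae g)) => t [F0 g0].
have [sF|/F0 ->] := pselect (esupp F (y - t)); last by rewrite mul0r.
have [sg|/g0 ->] := pselect (esupp g t); last by rewrite mulr0.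
exfalso; apply: nSy; apply: subset_closure.
by exists (y - t) => //; exists t => //; rewrite subrK.
Qed.

End extremizer.

(** * Associativity *)

Section associativity.
Context {R : realType}.
Local Notation mu := (@lebesgue_measure R).
Local Notation Int := (Rintegral mu [set: R]).
Implicit Types (M x y z : R) (A f g h F : R -> R).

Lemma Lp1P f : Lp 1%E f <-> mu.-integrable setT (EFin \o f).
Proof.
rewrite /Lp /finite_norm Lnorm1; split => [[mf foo]|/integrableP[mf foo]].
  by apply/integrableP; split => //; exact/measurable_EFinP.
by split => //; exact/measurable_EFinP.
Qed.

Lemma EFin_IntR f : mu.-integrable setT (EFin \o f) ->
  (\int[mu]_y (f y)%:E = (Int f)%:E)%E.
Proof. by move=> fi; rewrite /Rintegral fineK//; exact: integrable_fin_num. Qed.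

(** Setting $g$ to $0$ where it exceeds its essential bound turns a.e. bounds into pointwise ones,
    as the Fubini and Lipschitz estimates below require. *)
Lemma Lpy_bounded_rep g : Lp +oo%E g -> exists g' M,
  [/\ measurable_fun setT g', 0 <= M, forall y, `|g' y| <= M &
      {ae mu, forall y, g y = g' y}].
Proof.
move=> lg; have [mg _] := lg; set M := fine (normp +oo%E g).
have M0 : 0 <= M by rewrite fine_ge0// normp_ge0.
pose A : set R := (fun y => `|g y|) @^-1` `]-oo, M]%classic.
have mA : measurable A.
  rewrite -[X in measurable X]setTI.
  have : measurable_fun [set: R] (fun y => `|g y|) by exact: measurableT_comp.
  by apply => //; exact: measurable_itv.
exists (fun y => \1_A y * g y), M; split => //.
- by apply: measurable_funM => //; exact: measurable_indic.
- move=> y; rewrite indicE; case: (boolP (y \in A)) => [|_].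
    by rewrite inE mul1r /A /= in_itv.
  by rewrite mul0r normr0.
- apply: ae_imp (normpy_ae lg) => y gy.
  by rewrite indicE mem_set ?mul1r//= /A /= in_itv.
Qed.

(* Both the derivative of [lconv G h] and the associativity of the convolution
   are instances of this exchange of integrals, for [A] the kernel of [oint]
   and for [A] a reflected translate of [F] respectively. *)
Lemma IntR_conv_exchange A h g M : Lp 1%E A -> Lp 1%E h ->
  measurable_fun setT g -> (forall y, `|g y| <= M) ->
  Int (fun z => Int (fun y => A y * g (y - z)) * h z) =
  Int (fun y => A y * lconv g h y).
Proof.
move=> lA lh mg gM; have [mA _] := lA; have [mh _] := lh.
have lg : Lp +oo%E g by exact: Lpy_of_le gM.
have lg1 : Lp (conj_exp 1) g by rewrite conj_exp1.
have iA z : mu.-integrable setT (EFin \o (fun y => A y * g (y - z))).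
  apply: (integrable_conj (lexx 1) lA); apply: Lp_preserving lg1.
    by rewrite conj_exp1 leey.
  exact: mu_preserving_shiftN.
have ih y : mu.-integrable setT (EFin \o (fun z => g (y - z) * h z)).
  apply: conv_exists_sym; exact: (conv_exists_conj _ (lexx 1) lh lg1).
pose T := measurableTypeR R.
pose f (w : T * T) : \bar R := (A w.1 * g (w.1 - w.2) * h w.2)%:E.
have m1 : measurable_fun [set: T * T] (fun w : T * T => (w.1 : R)) by exact: measurable_fst.
have m2 : measurable_fun [set: T * T] (fun w : T * T => (w.2 : R)) by exact: measurable_snd.
have mf : measurable_fun [set: T * T] f.
  apply/measurable_EFinP; apply: measurable_funM.
    apply: measurable_funM; first exact: (measurableT_comp mA m1).
    exact: (measurableT_comp mg (measurable_funB m1 m2)).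
  exact: (measurableT_comp mh m2).
(* Tonelli's criterion: the inner integral of $|f|$ is at most $M\|h\|_1|A(y)|$, which is integrable
   in $y$. *)
have imf : (mu \x mu)%E.-integrable setT f.
  apply/integrable12ltyP => //.
  have M0 : 0 <= M := le_trans (normr_ge0 _) (gM 0).
  pose H := fine (\int[mu]_z `|h z|%:E)%E.
  have HE : (\int[mu]_z `|h z|%:E = H%:E)%E.
    rewrite /H fineK// ge0_fin_numE ?integral_ge0//.
    by case: lh => _; rewrite /finite_norm Lnorm1.
  apply: (@le_lt_trans _ _ (\int[mu]_y ((M * H)%:E * `|A y|%:E))%E).
    apply: ge0_le_integral => //.
    - by move=> y _; exact: integral_ge0.
    - apply: (@measurable_fun_fubini_tonelli_F _ _ T T R mu (fun w => `|f w|%E)) => //.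
      exact: measurableT_comp.
    - by apply: emeasurable_funM => //; apply/measurable_EFinP; exact: measurableT_comp.
    move=> y _; rewrite muleC EFinM muleA -HE -ge0_integralZl//; last 2 first.
    - by apply/measurable_EFinP; exact: measurableT_comp.
    - by rewrite -EFinM lee_fin mulr_ge0.
    apply: ge0_le_integral => //.
    - apply: measurableT_comp => //; exact: (measurable_fun_pair2 y mf).
    - by apply: emeasurable_funM => //; apply/measurable_EFinP; exact: measurableT_comp.
    - move=> z _; rewrite /f /= !normrM -!EFinM lee_fin ler_wpM2r// ler_wpM2l//.
  rewrite ge0_integralZl//; last 2 first.
  - by apply/measurable_EFinP; exact: measurableT_comp.
  - by rewrite lee_fin mulr_ge0// fine_ge0// integral_ge0.
  rewrite lte_mul_pinfty// ?lee_fin ?mulr_ge0 ?fine_ge0 ?integral_ge0//.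
  by case: lA => _; rewrite /finite_norm Lnorm1.
have := Fubini imf.
under eq_integral => y _.
  rewrite /f /=; under eq_integral => z _ do rewrite -mulrA.
  rewrite (EFin_IntR (f := fun z => A y * (g (y - z) * h z))); last first.
    by apply: eq_integrable (integrableZl measurableT (A y) (ih y)) => // z _; rewrite EFinM.
  rewrite IntRZ//; over.
under [X in _ = X -> _]eq_integral => z _.
  rewrite /f /= (EFin_IntR (f := fun y => A y * g (y - z) * h z)); last first.
    by apply: eq_integrable (integrableZr measurableT (h z) (iA z)) => // y _; rewrite EFinM.
  rewrite (_ : (fun y => _) = fun y => h z * (A y * g (y - z))); last first.
    by apply/funext => y; rewrite mulrC.
  rewrite IntRZ// mulrC; over.
by move=> E; rewrite /Rintegral; congr fine; rewrite E.
Qed.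

Lemma normp1_oint_kernel x : normp 1%:E (oint_kernel x) = `|x|%:E.
Proof.
rewrite /normp Lnorm1; have [x0|x0] := leP 0 x.
  rewrite oint_kernel_ge0//; transitivity (mu `]0, x]%classic).
    rewrite -[in RHS](setIT `]0, x]%classic) -integral_indic//.
    by apply: eq_integral => y _; rewrite /= ger0_norm.
  rewrite lebesgue_measure_itv/= lte_fin ger0_norm// oppr0 adde0.
  by case: ltgtP x0 => // <-.
rewrite (oint_kernel_le0 (ltW x0)); transitivity (mu `]x, 0]%classic).
  rewrite -[in RHS](setIT `]x, 0]%classic) -integral_indic//.
  by apply: eq_integral => y _; rewrite /= normrM normrN1 mul1r ger0_norm.
by rewrite lebesgue_measure_itv/= lte_fin x0 add0e ltr0_norm.
Qed.

Lemma oint_le g M x : measurable_fun setT g -> (forall y, `|g y| <= M) ->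
  `|oint g x| <= M * `|x|.
Proof.
move=> mg gM; have lg : Lp (conj_exp 1) g.
  by rewrite conj_exp1; exact: Lpy_of_le gM.
rewrite (ointE _ (lexx 1) lg) -lee_fin.
apply: le_trans (Rintegral_conj_le (lexx 1) (Lp_oint_kernel x (lexx 1)) lg) _.
rewrite normp1_oint_kernel muleC EFinM; apply: lee_pmul => //; first exact: normp_ge0.
by rewrite conj_exp1; apply: normpy_le; exact: aeW.
Qed.

(** By [oint_transl] the increment from $y$ to $x$ is the primitive of a translate of $g$ evaluated
    at $x-y$, so the linear growth bound applies. *)
Lemma oint_lipschitz g M x y : measurable_fun setT g -> (forall y, `|g y| <= M) ->
  `|oint g x - oint g y| <= M * `|x - y|.
Proof.
move=> mg gM; have lg : Lp (conj_exp 1) g.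
  by rewrite conj_exp1; exact: Lpy_of_le gM.
have := oint_transl (- y) (x - y) (lexx 1) lg; rewrite opprK subrK => <-.
apply: oint_le; last by move=> t; exact: gM.
exact: measurable_preserving (mu_preserving_shiftN _) mg.
Qed.

Lemma measurable_oint g M : measurable_fun setT g -> (forall y, `|g y| <= M) ->
  measurable_fun setT (oint g).
Proof.
move=> mg gM; apply: continuous_measurable_fun => x.
have M0 : 0 <= M := le_trans (normr_ge0 _) (gM 0).
apply/cvgrPdist_lt => e e0.
have d0 : 0 < e / (M + 1) by rewrite divr_gt0// ltr_wpDl.
exists (e / (M + 1)) => //= y xy.
apply: le_lt_trans (oint_lipschitz _ _ mg gM) _.
rewrite /ball_ /= ltr_pdivlMr ?ltr_wpDl// in xy.
by apply: le_lt_trans xy; rewrite mulrC ler_wpM2l// lerDl.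
Qed.

(** The primitive grows at most linearly, so the integrand is bounded by $M(|x|+|y|)|h(y)|$; this is
    where the first moment of $h$ enters. *)
Lemma conv_exists_oint g h M x : measurable_fun setT g -> (forall y, `|g y| <= M) ->
  Lp 1%E h -> mu.-integrable setT (fun y => (y * h y)%:E) ->
  conv_exists (oint g) h x.
Proof.
move=> mg gM lh yh; have M0 : 0 <= M := le_trans (normr_ge0 _) (gM 0).
have [mh _] := lh; move/Lp1P : lh => ih.
have i1 := integrableZl measurableT (M * `|x|) (integrable_abse ih).
have i2 := integrableZl measurableT M (integrable_abse yh).
apply: le_integrable (integrableD measurableT i1 i2) => //.
- apply/measurable_EFinP; apply: measurable_funM => //.
  exact: measurable_preserving (mu_preserving_refl x) (measurable_oint mg gM).
move=> y _; rewrite /= lee_fin [leRHS]ger0_norm; last by rewrite addr_ge0 ?mulr_ge0.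
rewrite !normrM !mulrA -mulrDl ler_wpM2r// -mulrDr.
by apply: le_trans (oint_le _ mg gM) _; rewrite ler_wpM2l// ler_normB.
Qed.

(** Subtracting the value at $0$ replaces $G(x-z)$ by $G(x-z)-G(-z)$, the primitive at $x$ of
    $g(\cdot-z)$. The exchange of integrals then shows that $g\ast h$ is the derivative of $G\ast
    h$. *)
Lemma lconv_oint g h M x : measurable_fun setT g -> (forall y, `|g y| <= M) ->
  Lp 1%E h -> mu.-integrable setT (fun y => (y * h y)%:E) ->
  lconv (oint g) h x - lconv (oint g) h 0 = oint (lconv g h) x.
Proof.
move=> mg gM lh yh; have [mh _] := lh.
have lg : Lp (conj_exp 1) g.
  by rewrite conj_exp1; exact: Lpy_of_le gM.
have lgh : Lp (conj_exp 1) (lconv g h).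
  rewrite (lconv_sym mg mh) conj_exp1; exact: (Lpy_lconv (lexx 1)).
rewrite (ointE _ (lexx 1) lgh) -(IntR_conv_exchange (Lp_oint_kernel x (lexx 1)) lh mg gM).
rewrite /lconv -IntRB; try exact: (conv_exists_oint _ mg gM).
apply: eq_IntR => z; rewrite -mulrBl sub0r -(oint_transl z x (lexx 1) lg).
rewrite (ointE _ (lexx 1))//; apply: Lp_preserving lg.
  by rewrite conj_exp1 leey.
exact: mu_preserving_shiftN.
Qed.

Lemma lconvA F g h M : Lp 1%E F -> Lp 1%E h ->
  measurable_fun setT g -> (forall y, `|g y| <= M) ->
  lconv F (lconv g h) = lconv (lconv F g) h.
Proof.
move=> lF lh mg gM; have [mF _] := lF; apply/funext => x.
have lFx := Lp_refl x (lexx 1) lF; have [mFx _] := lFx.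
rewrite {1}/lconv -(IntR_conv_exchange lFx lh mg gM).
apply: eq_IntR => z; congr (_ * _).
(* The substitution $y\mapsto y+z$ identifies the inner integral with $(F\ast g)(x-z)$. *)
rewrite -[LHS](Rintegral_preserving (mu_preserving_shift z)).
  by apply: eq_IntR => y; rewrite addrK opprD addrA addrAC.
apply: measurable_funM => //.
exact: measurable_preserving (mu_preserving_shiftN z) mg.
Qed.

Lemma dconv_lconv_assoc F G g h : Lp 1%:E F -> Iq_with (conj_exp 1) G g ->
  Lp 1%E h -> mu.-integrable setT (fun y => (y * h y)%:E) ->
  [/\ forall x, conv_exists G h x,
    inIq +oo%E (fun x => lconv G h x - lconv G h 0),
    forall x, conv_exists (dconv 1 F G) h x &
    dconv 1 F (fun x => lconv G h x - lconv G h 0) = lconv (dconv 1 F G) h].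
Proof.
move=> lF [lg GE] lh yh; have [mh _] := lh.
have [g' [M [mg' M0 g'M gg']]] : exists g' M, [/\ measurable_fun setT g', 0 <= M,
    forall y, `|g' y| <= M & {ae mu, forall y, g y = g' y}].
  by apply: Lpy_bounded_rep; rewrite -conj_exp1.
have lg' : Lp (conj_exp 1) g' by rewrite conj_exp1; exact: Lpy_of_le g'M.
(* A primitive depends only on the a.e. class of its density, so $G$ itself is unchanged when $g$ is
   replaced by $g'$. *)
have {}GE : G = oint g'.
  apply/funext => x; rewrite GE !(ointE _ (lexx 1))//.
  have [mk _] := Lp_oint_kernel x (lexx 1); have [mg _] := lg.
  apply: ae_eq_IntR; [exact: measurable_funM|exact: measurable_funM|].
  by apply: ae_imp gg' => y ->.
have Gg' : Iq_with (conj_exp 1) G g' by split=> // x; rewrite GE.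
have IGh : Iq_with (conj_exp 1) (fun x => lconv G h x - lconv G h 0) (lconv g' h).
  split=> [|x]; last by rewrite GE (lconv_oint _ mg' g'M).
  by rewrite (lconv_sym mg' mh) conj_exp1; exact: (Lpy_lconv (lexx 1)).
split.
- by move=> x; rewrite GE; exact: conv_exists_oint g'M lh yh.
- by exists (lconv g' h); rewrite -conj_exp1.
- move=> x; apply: conv_exists_sym; apply: (conv_exists_conj _ (lexx 1) lh).
  by rewrite conj_exp1 (dconv_IqE (lexx 1) lF Gg'); exact: (Lpy_lconv (lexx 1)).
- by rewrite (dconv_IqE (lexx 1) lF IGh) (dconv_IqE (lexx 1) lF Gg') (lconvA lF lh mg' g'M).
Qed.

End associativity.

(** * Assembly of (a) to (f) from the Lebesgue convolution *)

Theorem mainTheorem12 (R : realType) (p : R) (F g G : R -> R) :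
  1 <= p ->
  Lp p%:E F ->
  Iq_with (conj_exp p) G g ->
  (* (a) *)
  ((forall x, conv_exists F g x) /\ (forall x, conv_exists g F x) /\
   dconv p F G = lconv F g /\ lconv F g = lconv g F /\
   Lp +oo%E (dconv p F G) /\
   (normp +oo%E (dconv p F G) <= normp p%:E F * normp (conj_exp p) g)%E /\
   unif_continuous (dconv p F G)) /\
  (* (b) *)
  (forall k : R, dconv p F (fun=> k) = fun=> 0) /\
  (* (c) *)
  (p = 1 -> forall h : R -> R, Lp 1%E h ->
     (@lebesgue_measure R).-integrable [set: R] (fun y => (y * h y)%:E) ->
     (forall x, conv_exists G h x) /\
     inIq +oo%E (fun x => lconv G h x - lconv G h 0) /\
     (forall x, conv_exists (dconv p F G) h x) /\
     dconv p F (fun x => lconv G h x - lconv G h 0) = lconv (dconv p F G) h) /\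
  (* (d) *)
  (forall z : R, transl z (dconv p F G) = dconv p (transl z F) G /\
                 transl z (dconv p F G) = dconv p F (transl z G)) /\
  (* (e) Phi_f *)
  ((forall G1 G2 : R -> R, inIq (conj_exp p) G1 -> inIq (conj_exp p) G2 ->
      dconv p F (G1 \+ G2) = dconv p F G1 \+ dconv p F G2) /\
   (forall (a : R) (G1 : R -> R), inIq (conj_exp p) G1 ->
      dconv p F (fun x => a * G1 x) = (fun x => a * dconv p F G1 x)) /\
   (forall g1 : R -> R, Lp (conj_exp p) g1 -> Lp +oo%E (dconv p F (oint g1))) /\
   opnorm_Phi p F = normp p%:E F) /\
  (* (e) Psi_G *)
  ((forall F1 F2 : R -> R, Lp p%:E F1 -> Lp p%:E F2 ->
      dconv p (F1 \+ F2) G = dconv p F1 G \+ dconv p F2 G) /\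
   (forall (a : R) (F1 : R -> R), Lp p%:E F1 ->
      dconv p (fun x => a * F1 x) G = (fun x => a * dconv p F1 G x)) /\
   (forall F1 : R -> R, Lp p%:E F1 -> Lp +oo%E (dconv p F1 G)) /\
   (exists M : R, forall F1 : R -> R, Lp p%:E F1 ->
      (normp +oo%E (dconv p F1 G) <= M%:E * normp p%:E F1)%E) /\
   (1 < p -> opnorm_Psi p G = normp (conj_exp p) g) /\
   (p = 1 -> (opnorm_Psi p G <= normp +oo%E g)%E)) /\
  (* (f) *)
  esupp (dconv p F G) `<=` closure (minksum (esupp F) (esupp g)).
Proof.
move=> p1 lF Gg; have [lg GE] := Gg; have [mF _] := lF; have [mg _] := lg.
have q1 := conj_exp_ge1 p1; have p1e : (1 <= p%:E)%E by rewrite lee_fin.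
have dE := dconv_IqE p1 lF Gg.
have Iq v : Lp (conj_exp p) v -> Iq_with (conj_exp p) (oint v) v by [].
split; [|split; [|split; [|split; [|split; [|split]]]]].
- rewrite dE; split; first by move=> x; exact: conv_exists_conj lg.
  split; first by move=> x; apply: conv_exists_sym; exact: conv_exists_conj lg.
  split; first by [].
  split; first exact: lconv_sym.
  split; first exact: Lpy_lconv lg.
  split; first exact: normpy_lconv_le.
  exact: unif_continuous_lconv lg.
(* For a constant, $H-H(0)$ is the zero function, with derivative $0$. *)
- move=> k; have I0 : Iq_with (conj_exp p) (fun x : R => k - k) (fun=> 0).
    split=> [|x]; first exact: Lp0.
    rewrite subrr (ointE _ p1 (Lp0 q1)) -[LHS]IntR0.
    by apply: eq_IntR => t; rewrite mulr0.
  rewrite (dconvE p1 lF I0); apply/funext => x; rewrite /lconv -[RHS]IntR0.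
  by apply: eq_IntR => t; rewrite mulr0.
- move=> pE h lh yh; subst p.
  by have [? ? ? ?] := dconv_lconv_assoc lF Gg lh yh.
- move=> z; have pz := mu_preserving_shiftN z.
  have lFz : Lp p%:E (transl z F) by exact: Lp_preserving pz lF.
  (* The translate of $G$ need not vanish at $0$, hence need not lie in $I^q$; only its
     normalisation does, with density $\tau_z g$. *)
  have Gz : Iq_with (conj_exp p) (fun x => transl z G x - transl z G 0) (transl z g).
    split; first exact: Lp_preserving pz lg.
    by move=> x; rewrite (oint_transl z x p1 lg) /transl !GE sub0r.
  rewrite dE (dconv_IqE p1 lFz Gg) (dconvE p1 lF Gz).
  by rewrite lconv_transl_l lconv_transl_r.
- split; [|split; [|split]].
  + move=> G1 G2 [g1 I1] [g2 I2]; have [l1 E1] := I1; have [l2 E2] := I2.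
    have I12 : Iq_with (conj_exp p) (G1 \+ G2) (g1 \+ g2).
      by split=> [|x]; [exact: LpD|rewrite (ointD p1 l1 l2) /= E1 E2].
    rewrite (dconv_IqE p1 lF I12) (dconv_IqE p1 lF I1) (dconv_IqE p1 lF I2).
    exact: (lconvDr p1).
  + move=> a G1 [g1 I1]; have [l1 E1] := I1.
    have Ia : Iq_with (conj_exp p) (fun x => a * G1 x) (fun x => a * g1 x).
      by split=> [|x]; [exact: LpZ|rewrite (ointZ a p1 l1) E1].
    rewrite (dconv_IqE p1 lF Ia) (dconv_IqE p1 lF I1).
    exact: (lconvZr _ p1).
  + by move=> g1 l1; rewrite (dconv_IqE p1 lF (Iq g1 l1)); exact: Lpy_lconv l1.
  + exact: opnorm_PhiE.
- split; [|split; [|split; [|split; [|split]]]].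
  + move=> F1 F2 l1 l2; rewrite !(dconv_IqE p1 _ Gg)//; last exact: LpD.
    exact: (lconvDl p1).
  + move=> a F1 l1; rewrite !(dconv_IqE p1 _ Gg)//; last exact: LpZ.
    exact: (lconvZl _ p1).
  + by move=> F1 l1; rewrite (dconv_IqE p1 l1 Gg); exact: Lpy_lconv lg.
  + exists (fine (normp (conj_exp p) g)) => F1 l1.
    rewrite (dconv_IqE p1 l1 Gg) -(Lp_fine lg) muleC.
    exact: normpy_lconv_le.
  + by move=> p1'; exact: opnorm_PsiE.
  + move=> pE; have := opnorm_Psi_le p1 Gg.
    by rewrite pE conj_exp1.
- by rewrite dE; exact: esupp_lconv.
Qed.
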